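(* The set $\mathrm{SB}_{\mathrm F}=\{X\in \mathrm{SF}\mid X\text{ is normable}\}$ is Borel in $\mathrm{SF}$.
   Context: $C(\mathbb{R})$ is the Fréchet space of continuous real-valued functions on $\mathbb{R}$ with the topology of uniform convergence on compact sets. $\mathrm{SF}=\{X\subseteq C(\mathbb{R})\mid X\text{ is a closed vector subspace}\}$ with the Effros Borel structure, i.e., the $\sigma$-algebra generated by the sets $\{X\in\mathrm{SF}\mid X\cap U\neq\emptyset\}$, $U\subseteq C(\mathbb{R})$ open; it is a standard Borel space. $X\in\mathrm{SF}$ is normable if there is a norm on $X$ generating its (subspace) topology. *)

(* Defs.v *)
From HB Require Import structures.
From mathcomp Require Import all_boot all_order all_algebra.
From mathcomp Require Import all_classical all_reals all_analysis.

Set Implicit Arguments.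
Unset Strict Implicit.
Unset Printing Implicit Defensive.

Import Order.TTheory GRing.Theory Num.Theory.
Import numFieldNormedType.Exports.

Local Open Scope classical_set_scope.
Local Open Scope ring_scope.

Section continuous_functions.
Variable R : realType.

Definition cts : {pred R -> R} := mem [set f : R -> R | continuous f].

Lemma cts_submod_closed : submod_closed cts.
Proof.
split; first by rewrite inE => x; exact: cvg_cst.
move=> a f g; rewrite !inE => /= cf cg x.
by apply: continuousD; [apply: continuousM; [exact: cst_continuous|exact: cf]|
  exact: cg].
Qed.

HB.instance Definition _ :=
  GRing.isSubmodClosed.Build R (R -> R) cts cts_submod_closed.

Definition CR : Type := {f : R -> R | f \in cts}.

HB.instance Definition _ := SubChoice.on CR.
HB.instance Definition _ := [SubChoice_isSubLmodule of CR by <:].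
HB.instance Definition _ := Uniform.copy CR
  (initial_topology (val : CR -> {family compact, R -> R})).

End continuous_functions.

Section closed_subspaces.
Variable R : realType.

Record SF := MkSF {
  SF_set :> set (CR R) ;
  SF_submod : submod_closed (mem SF_set) ;
  SF_closed : closed SF_set }.

Lemma setT_submod : submod_closed (mem [set: CR R]).
Proof. by split=> [|a u v _ _]; rewrite inE. Qed.

HB.instance Definition _ := gen_eqMixin SF.
HB.instance Definition _ := gen_choiceMixin SF.
(* A measurable type must be pointed; C(R) itself is the chosen point. *)
HB.instance Definition _ := isPointed.Build SF (MkSF setT_submod closedT).

Definition hit (U : set (CR R)) : set SF := [set X | SF_set X `&` U !=set0].

Definition effros : set (set SF) := [set hit U | U in open].

HB.instance Definition _ := Measurable.copy SF (g_sigma_algebraType effros).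

Definition SF_pred (X : SF) : {pred CR R} := mem (SF_set X).

HB.instance Definition _ (X : SF) :=
  GRing.isSubmodClosed.Build R (CR R) (SF_pred X) (SF_submod X).

(* [X] as a vector space in its own right, with the subspace topology. *)
Definition SF_space (X : SF) : Type := {f : CR R | f \in SF_pred X}.

HB.instance Definition _ (X : SF) := SubChoice.on (SF_space X).
HB.instance Definition _ (X : SF) := [SubChoice_isSubLmodule of SF_space X by <:].
HB.instance Definition _ (X : SF) := Topological.copy (SF_space X)
  (initial_topology (val : SF_space X -> CR R)).

End closed_subspaces.

(* The axioms of [Lmodule_isNormed]; nonnegativity follows from them. *)
Definition is_norm (R : realType) (V : lmodType R) (p : V -> R) : Prop :=
  [/\ forall x y, p (x + y) <= p x + p y,
      forall (a : R) x, p (a *: x) = `|a| * p x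
    & forall x, p x = 0 -> x = 0].

Definition normable (R : realType) (X : SF R) : Prop :=
  exists p : SF_space X -> R, is_norm p /\
    forall x : SF_space X, nbhs x = nbhs_ball_ (ball_ p) x.

(* Main.v *)
Require Import Defs.
From HB Require Import structures.
From mathcomp Require Import all_boot all_order all_algebra.
From mathcomp Require Import all_classical all_reals all_analysis.
From mathcomp Require Import lra.

(** The topology of [CR R] is given by the increasing seminorms
    p_n(f) = sup_{|t| <= n} |f t|.  A closed subspace X is normable exactly when
    one of them already controls all the others on X: there is an n such that
    for every m some natural number C satisfies p_m <= C p_n on X
    ([normable_iff]).  In that case p_n itself is a norm on X generating its
    topology.  Conversely, if p is such a norm, continuity of p at 0 bounds p by
    a multiple of some p_n, and continuity of p_m at 0 for p bounds p_m by a
    multiple of p; both bounds come from homogeneity ([seminorm_domination]).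

    For fixed n, m and C, the functions with C p_n(f) < p_m(f) form an open set
    U of [CR R], and the inequality p_m <= C p_n holds on X if and only if X
    misses U.  Hence the set of normable subspaces is a countable union of
    countable intersections of countable unions of complements of generators of
    the Effros sigma-algebra.  *)

Set Implicit Arguments.
Unset Strict Implicit.
Unset Printing Implicit Defensive.

Import Order.TTheory GRing.Theory Num.Theory.
Import numFieldNormedType.Exports.
Local Open Scope classical_set_scope.
Local Open Scope ring_scope.

Definition supnorm (R : realType) (n : nat) (f : CR R) : R :=
  sup [set `|val f t| | t in `[- n%:R, n%:R]].

Section supnorm.
Variable R : realType.
Implicit Types (f g : CR R) (n m : nat).

Lemma CR_continuous f : continuous (val f).
Proof. by have := valP f; rewrite inE. Qed.

Lemma supnorm_le n f (M : R) :
  (forall t : R, `|t| <= n%:R -> `|val f t| <= M) -> supnorm n f <= M.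
Proof.
move=> fM; apply: ge_sup.
  by exists `|val f 0|, 0 => //=; rewrite in_itv/= oppr_le0 ler0n.
by move=> _ [t /= + <-]; rewrite in_itv/= -ler_norml; exact: fM.
Qed.

Lemma le_supnorm n f (t : R) : `|t| <= n%:R -> `|val f t| <= supnorm n f.
Proof.
move=> tn; apply: ub_le_sup; last by exists t => //=; rewrite in_itv/= -ler_norml.
suff [] : has_sup [set `|val f s| | s in `[- n%:R, n%:R]] by [].
apply: compact_has_sup.
  by exists `|val f t|, t => //=; rewrite in_itv/= -ler_norml.
apply: continuous_compact; last exact: segment_compact.
apply: continuous_subspaceT => s.
by apply: continuous_comp; [exact: CR_continuous|exact: norm_continuous].
Qed.

Lemma supnorm_ge0 n f : 0 <= supnorm n f.
Proof. by apply: le_trans (@le_supnorm n f 0 _); rewrite ?normr0. Qed.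

Lemma supnormD n f g : supnorm n (f + g) <= supnorm n f + supnorm n g.
Proof.
apply: supnorm_le => t tn.
by rewrite (le_trans (ler_normD _ _))// lerD// le_supnorm.
Qed.

Lemma supnormZ n (a : R) f : supnorm n (a *: f) = `|a| * supnorm n f.
Proof.
have Zle (b : R) h : supnorm n (b *: h) <= `|b| * supnorm n h.
  apply: supnorm_le => t tn.
  by rewrite [X in `|X|](_ : _ = b * val h t)// normrM ler_wpM2l// le_supnorm.
apply/eqP; rewrite eq_le Zle/=; have [->|a0] := eqVneq a 0.
  by rewrite normr0 mul0r supnorm_ge0.
by rewrite -ler_pdivlMl ?normr_gt0// -normfV -{1}[f](scalerK a0) Zle.
Qed.

Lemma supnormN n f : supnorm n (- f) = supnorm n f.
Proof. by rewrite -scaleN1r supnormZ normrN1 mul1r. Qed.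

Lemma ler_supnorm n m f : (n <= m)%N -> supnorm n f <= supnorm m f.
Proof.
move=> nm; apply: supnorm_le => t tn; apply: le_supnorm.
by rewrite (le_trans tn)// ler_nat.
Qed.

Lemma supnorm_eq0 f : (forall n, supnorm n f = 0) -> f = 0.
Proof.
move=> f0; apply: val_inj; apply/funext => t.
have [n tn] : exists n, `|t| <= n%:R :> R.
  by exists (Num.truncn `|t|).+1; rewrite ltW// truncnS_gt.
by apply/eqP; rewrite -normr_le0 -(f0 n) le_supnorm.
Qed.

(** A compact set lies in some [-n, n], so these balls form a neighbourhood
    basis for uniform convergence on compact sets. *)
Lemma nbhs_CR f (A : set (CR R)) : nbhs f A <->
  exists n e, 0 < e /\ [set g | supnorm n (f - g) < e] `<=` A.
Proof.
split.
- case=> _ [[B oB <-] Bf BA].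
  have nB : nbhs (val f : {family compact, R -> R}) B by exact: open_nbhs_nbhs.
  pose D := [set ne : nat * R | 0 < ne.2].
  pose N (ne : nat * R) : set (R -> R) :=
    [set g | forall t, `|t| <= ne.1%:R -> `|val f t - g t| < ne.2].
  have FN : Filter (filter_from D N).
    apply: filter_from_filter; first by exists (0%N, 1); rewrite /D/=.
    move=> [n e] [m d]; rewrite /D /N/= => e0 d0.
    exists (maxn n m, Num.min e d); first by rewrite /= lt_min e0.
    move=> g /= gfe; split=> t tnm.
      have := gfe t; rewrite lt_min (le_trans tnm) ?ler_nat ?leq_maxl//.
      by move=> /(_ isT)/andP[].
    have := gfe t; rewrite lt_min (le_trans tnm) ?ler_nat ?leq_maxr//.
    by move=> /(_ isT)/andP[].
  have /(_ B nB)[[n e] /= e0 NB] :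
      filter_from D N --> (val f : {family compact, R -> R}).
    apply/fam_cvgP => K cK P /uniform_nbhs[E [entE EP]].
    move: entE; rewrite -entourage_ballE => -[e /= e0 eE].
    have [M [_ KM]] := compact_bounded cK.
    (* [compact_bounded] bounds K only by numbers strictly above M. *)
    exists ((Num.truncn (M + 1)).+1, e) => //= g gfe.
    apply: EP => t Kt; apply: eE => /=; apply: gfe => /=.
    apply: le_trans (ltW (truncnS_gt (M + 1))).
    by apply: KM Kt; rewrite ltrDl.
  exists n, e; split=> // g /= fge; apply: BA; apply: NB => t tn /=.
  exact: le_lt_trans (@le_supnorm _ (f - g) _ tn) fge.
- move=> [n [e [e0 eA]]]; apply: (filterS eA).
  (* Pointwise strict bounds give only a weak bound on the supremum, hence the
     margin from e / 2 to e. *)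
  pose N : set (R -> R) := [set g |
    forall t, [set` `[- n%:R, n%:R]] t -> ball (val f t) (e / 2) (g t)].
  have nN : nbhs (val f : {family compact, R -> R}) N.
    apply: (@fam_nbhs _ _ compact _ [set xy : R * R | ball xy.1 (e / 2) xy.2]).
      by rewrite -entourage_ballE; exists (e / 2) => //=; rewrite divr_gt0.
    exact: segment_compact.
  have : nbhs f (val @^-1` N).
    exact: (@initial_continuous (CR R) {family compact, R -> R} val f _ nN).
  apply: filterS => g /= fg.
  apply: (@le_lt_trans _ _ (e / 2)); last by rewrite ltr_pdivrMr// ltr_pMr// ltr1n.
  apply: supnorm_le => t; rewrite ler_norml => tn; apply: ltW.
  by apply: fg; rewrite /= in_itv.
Qed.

(** Seminorms of the generating family are continuous, being 1-Lipschitz for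
    themselves; p_(max n m) dominates the two that occur here. *)
Lemma open_supnorm_lt n m (C : R) : 0 <= C ->
  open [set f | C * supnorm n f < supnorm m f].
Proof.
move=> C0; rewrite openE => f /= fC; apply/nbhs_CR.
(* With this e, the errors e in p_m and C e in C p_n add up to exactly the gap
   between the two sides at f. *)
pose e := (supnorm m f - C * supnorm n f) / (1 + C).
have C1 : 0 < 1 + C by rewrite ltr_wpDr.
have e0 : 0 < e by rewrite divr_gt0// subr_gt0.
have eC : e + C * e = supnorm m f - C * supnorm n f.
  by rewrite -{1}[e]mul1r -mulrDl mulrC divfK// gt_eqF.
exists (maxn n m), e; split=> // g /= fge.
have le_n := le_lt_trans (@ler_supnorm _ _ (f - g) (leq_maxl n m)) fge.
have le_m := le_lt_trans (@ler_supnorm _ _ (f - g) (leq_maxr n m)) fge.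
have Dm := supnormD m (f - g) g; rewrite subrK in Dm.
have Dn := supnormD n (g - f) f; rewrite subrK -opprB supnormN in Dn.
have : C * supnorm n g <= C * (e + supnorm n f).
  by rewrite ler_wpM2l// (le_trans Dn)// lerD2r ltW.
rewrite mulrDr; lra.
Qed.

End supnorm.

(** If p x were larger than q x / e, the vector x / p x would have q < e, hence
    p < 1, whereas its p is 1. *)
Lemma seminorm_domination (R : realType) (V : lmodType R) (p q : V -> R) (e : R) :
  (forall (a : R) x, p (a *: x) = `|a| * p x) ->
  (forall (a : R) x, q (a *: x) = `|a| * q x) ->
  (forall x, 0 <= q x) -> 0 < e ->
  (forall x, q x < e -> p x < 1) -> forall x, e * p x <= q x.
Proof.
move=> pZ qZ q0 e0 qp x; rewrite leNgt; apply/negP => qx.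
have px0 : 0 < p x by rewrite -(pmulr_rgt0 _ e0) (le_lt_trans (q0 x)).
have : p ((p x)^-1 *: x) < 1.
  by apply: qp; rewrite qZ ger0_norm ?invr_ge0 1?ltW// ltr_pdivrMl// mulrC.
by rewrite pZ ger0_norm ?invr_ge0 1?ltW// mulVf ?ltxx// gt_eqF.
Qed.

Lemma is_norm_ge0 (R : realType) (V : lmodType R) (p : V -> R) :
  is_norm p -> forall x, 0 <= p x.
Proof.
move=> [pD pZ _] x; have p0 : p 0 = 0 by rewrite -(scale0r 0) pZ normr0 mul0r.
have := pD x (- x); rewrite subrr p0 -scaleN1r pZ normrN1 mul1r.
lra.
Qed.

Lemma nbhs_SF_space (R : realType) (X : SF R) (x : SF_space X)
    (A : set (SF_space X)) : nbhs x A <->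
  exists n e, 0 < e /\ [set y | supnorm n (val x - val y) < e] `<=` A.
Proof.
split.
- case=> _ [[B oB <-] Bx BA].
  have /nbhs_CR[n [e [e0 eB]]] : nbhs (val x) B by exact: open_nbhs_nbhs.
  by exists n, e; split=> // y /= /eB/BA.
- move=> [n [e [e0 eA]]]; apply: (filterS eA).
  have /(@initial_continuous (SF_space X) (CR R) val x) /= :
      nbhs (val x) [set g | supnorm n (val x - g) < e].
    by apply/nbhs_CR; exists n, e; split.
  exact.
Qed.

(** C ranges over the natural numbers so that the right-hand side is built from
    countable unions and intersections.  From right to left, p_n is a norm because
    p_n x = 0 forces p_m x = 0 for all m. *)
Lemma normable_iff (R : realType) (X : SF R) : normable X <->
  exists n, forall m, exists C : nat,
    forall f, SF_set X f -> supnorm m f <= C%:R * supnorm n f.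
Proof.
pose q n (x : SF_space X) : R := supnorm n (val x).
have qZ n a x : q n (a *: x) = `|a| * q n x by exact: supnormZ.
split.
- move=> [p [np nbhsE]]; have [_ pZ _] := np; have p0 := is_norm_ge0 np.
  have pN x : p (- x) = p x by rewrite -scaleN1r pZ normrN1 mul1r.
  have : nbhs (0 : SF_space X) [set x | p x < 1].
    by rewrite nbhsE; exists 1 => //= x /=; rewrite sub0r pN.
  move=> /nbhs_SF_space[n [e [e0 eA]]].
  have pq : forall x, e * p x <= q n x.
    apply: seminorm_domination => //; first by move=> x; exact: supnorm_ge0.
    by move=> x xe; apply: eA; rewrite /= sub0r supnormN.
  exists n => m.
  have : nbhs (0 : SF_space X) [set x | q m x < 1].
    by apply/nbhs_SF_space; exists m, 1; split=> // x /=; rewrite sub0r supnormN.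
  rewrite nbhsE => -[d /= d0 dA].
  have qp : forall x, d * q m x <= p x.
    apply: seminorm_domination => // x xd; apply: dA.
    by rewrite /= sub0r pN.
  exists (Num.truncn (e * d)^-1).+1 => f Xf.
  have fX : f \in SF_pred X by rewrite inE.
  have edf : e * d * supnorm m f <= supnorm n f.
    apply: le_trans (pq (Sub f fX)); rewrite -mulrA ler_pM2l//.
    exact: (qp (Sub f fX)).
  apply: (@le_trans _ _ ((e * d)^-1 * supnorm n f)).
    by rewrite ler_pdivlMl// mulr_gt0.
  by rewrite ler_wpM2r ?supnorm_ge0// ltW// truncnS_gt.
- move=> [n qn].
  have {}qn m : exists2 C : R, 0 < C & forall x, q m x <= C * q n x.
    have [C qC] := qn m; exists C.+1%:R => // x.
    have Xx : SF_set X (val x) by have := valP x; rewrite inE.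
    by rewrite (le_trans (qC _ Xx))// ler_wpM2r ?supnorm_ge0// ler_nat.
  exists (q n); split.
    split; [by move=> x y; exact: supnormD|exact: qZ|move=> x x0].
    apply: val_inj; apply: supnorm_eq0 => m; apply/eqP.
    rewrite eq_le supnorm_ge0 andbT; have [C _ /(_ x)] := qn m.
    by rewrite x0 mulr0.
  move=> x; apply/seteqP; split=> A.
    move=> /nbhs_SF_space[m [e [e0 eA]]]; have [C C0 qC] := qn m.
    exists (e / C); first by rewrite /= divr_gt0.
    move=> y /= xy; apply: eA; apply: le_lt_trans (qC (x - y)) _.
    by rewrite mulrC -ltr_pdivlMr.
  by move=> [e /= e0 eA]; apply/nbhs_SF_space; exists n, e; split.
Qed.

Theorem proposition3p4 (R : realType) :
  measurable [set X : SF R | normable X].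
Proof.
rewrite (_ : [set X | _] = \bigcup_n \bigcap_m \bigcup_C
    ~` hit [set f : CR R | C%:R * supnorm n f < supnorm m f]).
  apply: bigcup_measurable => n _; apply: bigcap_measurable => // m _.
  apply: bigcup_measurable => C _; apply: measurableC.
  apply: sub_sigma_algebra.
  exists [set f : CR R | C%:R * supnorm n f < supnorm m f] => //.
  exact: open_supnorm_lt.
apply/seteqP; split=> X.
- move=> /normable_iff[n qn]; exists n => // m _; have [C qC] := qn m.
  by exists C => // -[f [Xf /=]]; rewrite ltNge qC.
- move=> [n _ qn]; apply/normable_iff; exists n => m.
  have [C _ qC] := qn m I; exists C => f Xf.
  by rewrite leNgt; apply/negP => fC; apply: qC; exists f.
Qed.
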